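(* Let $n$ be a positive integer. The map $\pi \mapsto \bigl( \stackrel{\circ}{\pi}, \widehat{\pi} \bigr)$, which sends a non-crossing linked partition $\pi$ of $\{1,\ldots,n\}$ to the pair consisting of its cycled unlinking $\stackrel{\circ}{\pi}$ and the partition $\widehat{\pi}$ generated by $\pi$, is a bijection from $NCL(n)$ onto the set $\{ (\alpha,\beta) \mid \alpha,\beta \in NC(n),\ \alpha \ll \beta \}$.
   Context: $NC(n)$ denotes the set of non-crossing partitions of $\{1,\ldots,n\}$. For $\alpha,\beta\in NC(n)$, $\alpha\le\beta$ (reverse refinement order) means that every block of $\beta$ is a union of blocks of $\alpha$. For $\alpha,\beta\in NC(n)$, $\alpha\ll\beta$ means that $\alpha\le\beta$ and, in addition, for every block $W$ of $\beta$ there exists a block $V$ of $\alpha$ such that $\min(W),\max(W)\in V$. A linked partition of $\{1,\ldots,n\}$ is a set $\pi=\{A_1,\ldots,A_p\}$ of non-empty subsets of $\{1,\ldots,n\}$ (called the blocks of $\pi$) such that $A_1\cup\cdots\cup A_p=\{1,\ldots,n\}$ and such that for all $i\ne j$ either $A_i\cap A_j=\emptyset$, or the following holds: $|A_i|\ge 2$, $|A_j|\ge 2$, $|A_i\cap A_j|=1$, $\min(A_i)\ne\min(A_j)$, and the unique element of $A_i\cap A_j$ is one of $\min(A_i),\min(A_j)$. Every $m\in\{1,\ldots,n\}$ belongs to exactly one or exactly two blocks of $\pi$; in the first case $m$ is called singly-covered by $\pi$, in the second case doubly-covered by $\pi$. A linked partition $\pi$ is non-crossing if there do not exist two distinct blocks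 $A,B$ of $\pi$ and elements $a,a'\in A$, $b,b'\in B$ with $a<b<a'<b'$. $NCL(n)$ denotes the set of all non-crossing linked partitions of $\{1,\ldots,n\}$. For a linked partition $\pi=\{A_1,\ldots,A_p\}$: $\widehat{\pi}$, the partition generated by $\pi$, is the smallest (with respect to reverse refinement order) partition $\beta$ of $\{1,\ldots,n\}$ such that every block of $\pi$ is contained in a block of $\beta$. The unlinking $\check{\pi}$ of $\pi$ is the partition $\{V_1,\ldots,V_p\}$, where $V_i=A_i$ if $\min(A_i)$ is singly-covered by $\pi$, and $V_i=A_i\setminus\{\min(A_i)\}$ if $\min(A_i)$ is doubly-covered by $\pi$. If $\pi\in NCL(n)$ then $\widehat{\pi},\check{\pi}\in NC(n)$. For a permutation $\tau$ of $\{1,\ldots,n\}$ and a partition $\alpha=\{V_1,\ldots,V_p\}$ of $\{1,\ldots,n\}$, put $\tau\cdot\alpha:=\{\tau(V_1),\ldots,\tau(V_p)\}$. For $\alpha\in NC(n)$, $P_\alpha$ is the permutation of $\{1,\ldots,n\}$ which on each block $V=\{i_1<\cdots<i_m\}$ of $\alpha$ acts as the cycle $P_\alpha(i_1)=i_2,\ldots,P_\alpha(i_{m-1})=i_m$, $P_\alpha(i_m)=i_1$. For $\pi\in NCL(n)$, the cycled unlinking of $\pi$ is the partition $\stackrel{\circ}{\pi}:=P_{\widehat{\pi}}^{-1}\cdot\check{\pi}$. *)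

(* Defs.v *)
From mathcomp Require Import all_boot fingroup perm.

Set Implicit Arguments.
Unset Strict Implicit.
Unset Printing Implicit Defensive.

(* The ground set {1, ..., n} is represented by 'I_n = {0, ..., n-1}, with the
   order of nat; a family of blocks is a set of subsets of 'I_n. *)
Section Definitions.

Variable n : nat.
Implicit Types (A B V W S : {set 'I_n}) (m x : 'I_n).
Implicit Types (pi alpha beta gamma : {set {set 'I_n}}).

(* is_min A m means m = min(A); it has a unique solution m when A is nonempty. *)
Definition is_min A m := (m \in A) && [forall x in A, m <= x].
Definition is_max A m := (m \in A) && [forall x in A, x <= m].

Definition noncrossing pi :=
  [forall A in pi, forall B in pi, (A != B) ==>
    ~~ [exists a in A, exists b in B, exists a' in A, exists b' in B,
          [&& a < b, b < a' & a' < b']]].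

Definition NC : {set {set {set 'I_n}}} :=
  [set alpha | partition alpha [set: 'I_n] & noncrossing alpha].

Definition refines alpha beta :=
  [forall W in beta, exists P : {set {set 'I_n}},
     (P \subset alpha) && (W == cover P)].

Definition ll alpha beta :=
  refines alpha beta &&
  [forall W in beta, exists V in alpha,
     [forall m, (is_min W m || is_max W m) ==> (m \in V)]].

Definition linked A B :=
  [&& 2 <= #|A|, 2 <= #|B|, #|A :&: B| == 1,
      ~~ [exists m, is_min A m && is_min B m]
    & [forall m in A :&: B, is_min A m || is_min B m]].

Definition linked_partition pi :=
  [&& set0 \notin pi, cover pi == [set: 'I_n]
    & [forall A in pi, forall B in pi, (A != B) ==>
         ([disjoint A & B] || linked A B)]].

Definition NCL : {set {set {set 'I_n}}} :=
  [set pi | linked_partition pi & noncrossing pi].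

Definition doubly_covered pi m := #|[set A in pi | m \in A]| == 2.

Definition coarsens pi beta :=
  partition beta [set: 'I_n] && [forall A in pi, exists B in beta, A \subset B].

Definition is_generated pi beta :=
  coarsens pi beta &&
  [forall gamma : {set {set 'I_n}}, coarsens pi gamma ==> refines beta gamma].

(* The default value set0 is never used if the blocks are nonempty (hatP). *)
Definition hat pi : {set {set 'I_n}} :=
  odflt set0 [pick beta | is_generated pi beta].

(* The subtracted set is {min(A)} if min(A) is doubly covered, else empty. *)
Definition unlink_block pi A :=
  A :\: [set m | is_min A m & doubly_covered pi m].

Definition unlinking pi : {set {set 'I_n}} := [set unlink_block pi A | A in pi].

Definition perm_act (tau : {perm 'I_n}) alpha : {set {set 'I_n}} :=
  [set [set tau x | x in V] | V : {set 'I_n} in alpha].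

(* enum V lists V in increasing order, and next is the cyclic successor. *)
Definition cycle_fun alpha x : 'I_n := next (enum (pblock alpha x)) x.

(* The default value 1 is never used when alpha is a partition: see
   cycle_permE below. *)
Definition cycle_perm alpha : {perm 'I_n} :=
  insubd (1%g : {perm 'I_n}) (finfun (cycle_fun alpha)).

Definition cycled_unlinking pi : {set {set 'I_n}} :=
  perm_act (cycle_perm (hat pi))^-1%g (unlinking pi).

Lemma cycle_permE alpha : trivIset alpha -> cycle_perm alpha =1 cycle_fun alpha.
Proof.
move=> tI x.
have mem y : (cycle_fun alpha y \in pblock alpha y) = (y \in pblock alpha y).
  by rewrite -[LHS]mem_enum mem_next mem_enum.
have out y : y \notin cover alpha -> cycle_fun alpha y = y.
  rewrite -mem_pblock /cycle_fun next_nth mem_enum.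
  by case: ifP.
have same y : y \in cover alpha ->
  (cycle_fun alpha y \in cover alpha) /\
  pblock alpha (cycle_fun alpha y) = pblock alpha y.
  move=> cy; have fy : cycle_fun alpha y \in pblock alpha y.
    by rewrite mem mem_pblock.
  have py := pblock_mem cy; split; last exact: def_pblock fy.
  by apply/bigcupP; exists (pblock alpha y).
have inj : injectiveb (finfun (cycle_fun alpha)).
  apply/injectiveP => y z; rewrite !ffunE => eq_yz.
  case: (boolP (y \in cover alpha)) => cy; case: (boolP (z \in cover alpha)) => cz.
  - have [_ ey] := same _ cy; have [_ ez] := same _ cz.
    have eP : pblock alpha y = pblock alpha z by rewrite -ey eq_yz ez.
    move: eq_yz; rewrite /cycle_fun eP => /(congr1 (prev (enum (pblock alpha z)))).
    by rewrite !prev_next ?enum_uniq.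
  - have [cfy _] := same _ cy; move: cfy; rewrite eq_yz out //.
    by rewrite (negPf cz).
  - have [cfz _] := same _ cz; move: cfz; rewrite -eq_yz out //.
    by rewrite (negPf cy).
  - by rewrite -(out y cy) -(out z cz).
by rewrite /cycle_perm -pvalE -[pval _]/(val _) val_insubd inj ffunE.
Qed.

Lemma hatP pi : set0 \notin pi -> is_generated pi (hat pi).
Proof.
move=> pi0; rewrite /hat; case: pickP => [// | none].
pose e x y := [forall gamma : {set {set 'I_n}},
                 coarsens pi gamma ==> (y \in pblock gamma x)].
have eP x y : reflect
    (forall gamma, coarsens pi gamma -> y \in pblock gamma x) (e x y).
  by apply: (iffP forallP) => h g; [apply/implyP | apply/implyP/h].
have eR : {in [set: 'I_n] & &, equivalence_rel e}.
  move=> x y z _ _ _; split.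
    apply/eP => g /andP[/and3P[/eqP cg _ _] _].
    by rewrite mem_pblock cg inE.
  move=> exy; apply/eP/eP => h g cg; have := h g cg; have := (eP _ _ exy) g cg;
  have /andP[/and3P[/eqP _ tg _] _] := cg;
  by move=> /(same_pblock tg) ->.
pose beta := equivalence_partition e [set: 'I_n].
have pb : partition beta [set: 'I_n] := equivalence_partitionP eR.
have /negP[] := none beta; apply/andP; split.
  rewrite /coarsens pb; apply/forall_inP => A Api.
  have [x xA] : exists x, x \in A.
    by apply/set0Pn; apply: contra pi0 => /eqP <-.
  apply/existsP; exists (pblock beta x); apply/andP; split.
    by apply: pblock_mem; rewrite (cover_partition pb) inE.
  apply/subsetP => y yA; rewrite pblock_equivalence_partition ?inE //.
  apply/eP => g /andP[/and3P[/eqP _ tg _] /forall_inP/(_ _ Api)/existsP[B]].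
  case/andP=> Bg /subsetP sAB.
  by rewrite (def_pblock tg Bg (sAB _ xA)) sAB.
apply/forall_inP => g cg; apply/forall_inP => W Wg.
apply/existsP; exists [set B in beta | B \subset W]; apply/andP; split.
  by apply/subsetP => B; rewrite inE => /andP[].
have /andP[/and3P[_ tg _] _] := cg.
apply/eqP/setP => x; apply/idP/bigcupP => [xW | [B]]; last first.
  by rewrite inE => /andP[_ /subsetP]; apply.
have xb : x \in cover beta by rewrite (cover_partition pb) inE.
exists (pblock beta x); last by rewrite mem_pblock.
rewrite inE pblock_mem //=; apply/subsetP => y.
rewrite pblock_equivalence_partition ?inE // => /eP/(_ _ cg).
by rewrite (def_pblock tg Wg xW).
Qed.

End Definitions.

(* Main.v *)
Require Import Defs.
From mathcomp Require Import all_boot fingroup perm zify.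

(** Both kinds of partitions are encoded by functions on the points, and the
    theorem becomes a statement about these functions.

    A partition is the family of fibers of its min function m, which sends x to
    the minimum of the block of x (partition_min_function, min_function_inj). A
    linked partition is likewise encoded by the function p that sends x to the
    minimum of the block containing x as a non-minimal element, or to x when
    there is no such block: two distinct blocks never share their minimum, and
    the block with minimum a consists of a and of the points sent to a
    (linked_partition_arc_blocks). In this way linked partitions correspond to
    the functions with p x <= x, drawn as arcs from p x to x. In both encodings
    the family is non-crossing exactly when p x < p y < x < y never happens, that
    is, when no two arcs cross.

    Three operations on linked partitions become simple:
    - two points lie in the same block of the generated partition iff iterating
      p leads them to the same fixed point, so that partition has min function
      root p (hat_arc_blocks);
    - removing the doubly covered minima leaves exactly the fibers of p
      (unlinking_arc_blocks);
    - if P is the cyclic successor in the blocks of the generated partition, the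
      cycled unlinking has the fibers of p \o P as its blocks (perm_act_fibers).

    The key point is that p \o P is again a min function
    (arcs_shift_min_function). First, p (P x) <= x: either P x is the successor
    of x in its block and p sends it strictly lower within this block, or P x is
    the first element of the block, which p fixes. Second, if p sends some x > a
    to a, then it sends P a to a as well, since otherwise the arc of P a would
    start below a and cross the arc from a to x; so a itself lies in the fiber of
    p \o P over a. Moreover p \o P sends the last element of a block of the
    generated partition to the first one, which is the relation ll.

    Hence a pair (alpha, beta), with min functions m and r, can only come from
    the function p with p (P x) = m x, P being read off from beta; this gives
    injectivity. Conversely, that p has non-crossing arcs and root p = r
    (min_function_unshift_arcs), which gives surjectivity. *)

Set Implicit Arguments.
Unset Strict Implicit.
Unset Printing Implicit Defensive.

(** * Partitions as fibers of min functions *)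

Section Fibers.

Variable n : nat.
Implicit Types (f g h p m r : 'I_n -> 'I_n) (a b x y z : 'I_n).
Implicit Types (A B V W : {set 'I_n}) (alpha beta pi : {set {set 'I_n}}).

Definition fibers f : {set {set 'I_n}} := preim_partition f [set: 'I_n].

Lemma fibersP f V :
  reflect (exists x, V = [set y | f x == f y]) (V \in fibers f).
Proof.
apply: (iffP imsetP) => [[x _ ->] | [x ->]]; exists x => //;
  by apply/setP => y; rewrite !inE.
Qed.

Lemma mem_fibers f x : [set y | f x == f y] \in fibers f.
Proof. by apply/fibersP; exists x. Qed.

Lemma fibers_partition f : partition (fibers f) [set: 'I_n].
Proof. exact: preim_partitionP. Qed.

Lemma mem_pblock_fibers f x y : (y \in pblock (fibers f) x) = (f x == f y).
Proof.
rewrite pblock_equivalence_partition ?inE // => a b c _ _ _.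
by split=> // /eqP->.
Qed.

Lemma eq_fibersP f g :
  (forall x y, (f x == f y) = (g x == g y)) <-> fibers f = fibers g.
Proof.
split=> [efg | efg x y]; last by rewrite -!mem_pblock_fibers efg.
rewrite /fibers /preim_partition /equivalence_partition.
by apply: eq_in_imset => x _; apply/setP => y; rewrite !inE efg.
Qed.

Lemma refines_fibers f g :
  refines (fibers f) (fibers g) <-> forall x y, f x = f y -> g x = g y.
Proof.
split=> [/forall_inP refl x y fxy | fg].
  have /existsP[P /andP[/subsetP sP /eqP eP]] := refl _ (mem_fibers g x).
  have: x \in cover P by rewrite -eP inE.
  case/bigcupP=> V PV; have /fibersP[z eV] := sP _ PV; rewrite eV inE => fzx.
  have: y \in cover P.
    by apply/bigcupP; exists V => //; rewrite eV inE -fxy.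
  by rewrite -eP inE => /eqP.
apply/forall_inP => W /fibersP[x ->]; apply/existsP.
exists [set V in fibers f | V \subset [set y | g x == g y]]; apply/andP; split.
  by apply/subsetP => V; rewrite inE => /andP[].
apply/eqP/setP => y; apply/idP/bigcupP => [|[V]]; last first.
  by rewrite inE => /andP[_ /subsetP]; apply.
rewrite inE => /eqP gxy; exists [set z | f y == f z]; last by rewrite inE.
rewrite inE mem_fibers; apply/subsetP => z; rewrite !inE => /eqP/fg <-.
exact/eqP.
Qed.

Definition deflationary f := forall x, f x <= x.

Definition arc_noncrossing f := forall x y, ~ [/\ f x < f y, f y < x & x < y].

(** These are exactly the functions sending each point to the minimum of its
    fiber: f x lies in the fiber of x and is below all its elements. *)
Definition min_function f := deflationary f /\ forall x, f (f x) = f x.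

Lemma min_function_inj f g :
  min_function f -> min_function g -> fibers f = fibers g -> f =1 g.
Proof.
move=> [df ff] [dg gg] /eq_fibersP efg x; apply: val_inj => /=.
have e1 : f (g x) = f x by apply/eqP; rewrite efg gg.
have e2 : g (f x) = g x by apply/eqP; rewrite -efg ff.
by have := df (g x); have := dg (f x); rewrite e1 e2; lia.
Qed.

Lemma partition_min_function alpha : partition alpha [set: 'I_n] ->
  exists2 m, min_function m & alpha = fibers m.
Proof.
move=> pa; have /and3P[/eqP ca ta _] := pa.
have xx x : x \in pblock alpha x by rewrite mem_pblock ca inE.
pose m x := [arg min_(a < x in pblock alpha x) a].
have mE x : m x \in pblock alpha x /\ forall y, y \in pblock alpha x -> m x <= y.
  by rewrite /m; case: arg_minnP.
have sameE x y : m x = m y -> pblock alpha x = pblock alpha y.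
  move=> mxy; have [mx _] := mE x; have [my _] := mE y.
  by rewrite -(same_pblock ta mx) mxy (same_pblock ta my).
have eqm x y : pblock alpha x = pblock alpha y -> m x = m y.
  move=> exy; have [mx hx] := mE x; have [my hy] := mE y.
  have := hx (m y); have := hy (m x); rewrite -{1}exy mx exy my.
  by move=> /(_ isT) ? /(_ isT) ?; apply: val_inj => /=; lia.
exists m; first split=> x.
- by have [_ ->] := mE x.
- by apply/eqm/(same_pblock ta); case: (mE x).
rewrite -(preim_partition_pblock pa) /fibers /preim_partition.
rewrite /equivalence_partition; apply: eq_in_imset => x _; apply/setP => y.
by rewrite !inE; apply/eqP/eqP => [/eqm | /sameE].
Qed.

(** Any crossing of two fibers yields a crossing of two arcs that start at the
    minima; which two of the four points end these arcs depends on the order of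
    the minima. *)
Lemma no_crossing m a b a' b' : min_function m -> arc_noncrossing m ->
  a < b -> b < a' -> a' < b' -> m a = m a' -> m b = m b' -> m a = m b.
Proof.
move=> [dm _] nc ab ba ab' ma mb; apply: val_inj => /=.
have da := dm a; have db := dm b.
have [lt | lt | //] := ltngtP (m a) (m b).
  by case: (nc a' b'); rewrite -ma -mb; split; lia.
by case: (nc b a'); rewrite -ma; split; lia.
Qed.

Lemma noncrossing_fibers m : min_function m ->
  noncrossing (fibers m) <-> arc_noncrossing m.
Proof.
move=> [dm mm]; split=> [nc x y [h1 h2 h3] | nc].
  have := forall_inP (forall_inP nc _ (mem_fibers m x)) _ (mem_fibers m y).
  have -> /= : [set z | m x == m z] != [set z | m y == m z].
    apply/eqP=> /setP/(_ x); rewrite !inE eqxx => /esym/eqP e.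
    by move: h1; rewrite e; lia.
  case/negP; apply/exists_inP; exists (m x); first by rewrite inE mm.
  apply/exists_inP; exists (m y); first by rewrite inE mm.
  apply/exists_inP; exists x; first by rewrite inE.
  by apply/exists_inP; exists y; rewrite ?inE ?h1 ?h2.
apply/forall_inP=> A /fibersP[u ->]; apply/forall_inP=> B /fibersP[v ->].
apply/implyP => uv.
apply/negP => /exists_inP[a]; rewrite inE => /eqP ma.
case/exists_inP=> b; rewrite inE => /eqP mb.
case/exists_inP=> a'; rewrite inE => /eqP ma'.
case/exists_inP=> b'; rewrite inE => /eqP mb' /and3P[ab ba ab'].
have := no_crossing (conj dm mm) nc ab ba ab'; rewrite -ma -ma' -mb -mb'.
by move=> /(_ erefl erefl) e; rewrite e eqxx in uv.
Qed.

Lemma NC_fibers m : min_function m -> fibers m \in NC n <-> arc_noncrossing m.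
Proof.
by move=> mm; rewrite inE fibers_partition /=; apply: noncrossing_fibers.
Qed.

Lemma NCP alpha : alpha \in NC n ->
  exists m, [/\ min_function m, arc_noncrossing m & alpha = fibers m].
Proof.
move=> aNC; move: (aNC); rewrite inE => /andP[/partition_min_function[m mm ea] _].
by exists m; split=> //; apply/(NC_fibers mm); rewrite -ea.
Qed.

(** Inside one block of the coarser partition, having the minimum and the
    maximum in a common block forces the finer min function to send the maximum
    to the minimum of the coarser block. *)
Lemma ll_fibers m r : min_function m -> min_function r ->
  ll (fibers m) (fibers r) <->
  (forall x, r (m x) = r x) /\
  (forall x, (forall y, r y = r x -> y <= x) -> m x = r x).
Proof.
move=> [dm mm] [dr rr].
have is_minE x a : is_min [set y | r x == r y] a <-> a = r x.
  split=> [/andP[] | ->]; last first.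
    rewrite /is_min inE rr eqxx; apply/forall_inP => y.
    by rewrite inE => /eqP ->.
  rewrite inE => /eqP e /forall_inP/(_ (r x)).
  rewrite inE rr eqxx => /(_ isT) ?; have := dr a; rewrite -e => ?.
  by apply: val_inj => /=; lia.
split=> [/andP[/refines_fibers ref /forall_inP mx] | [rm mx]].
  have rm x : r (m x) = r x by apply: ref.
  split=> // x xmax.
  have /exists_inP[V /fibersP[z ->] /forallP hV] := mx _ (mem_fibers r x).
  have: r x \in [set y | m z == m y].
    by apply: (implyP (hV _)); apply/orP; left; apply/is_minE.
  have: x \in [set y | m z == m y].
    apply: (implyP (hV _)); apply/orP; right; rewrite /is_max inE eqxx /=.
    by apply/forall_inP => y; rewrite inE => /eqP /esym/xmax.
  rewrite !inE => /eqP-> /eqP e; apply: val_inj => /=.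
  have := dr (m x); rewrite rm; have := dm (r x); rewrite -e; lia.
apply/andP; split.
  by apply/refines_fibers => x y e; rewrite -rm e rm.
apply/forall_inP => W /fibersP[x ->].
apply/exists_inP; exists [set y | m (r x) == m y]; first exact: mem_fibers.
apply/forallP => z; apply/implyP => /orP[/is_minE -> | ]; first by rewrite inE.
case/andP; rewrite !inE => /eqP exz /forall_inP zmax.
rewrite (mx z) -?exz //; last by move=> y e; apply: zmax; rewrite inE e.
apply/eqP/val_inj => /=.
by have := dm (r x); have := dr (m (r x)); rewrite rm rr; lia.
Qed.

(** * Linked partitions as arc diagrams *)

(** Only values of p may serve as minima: a point outside the image of p would
    contribute a spurious singleton besides the block it is sent into. *)
Definition arc_blocks p : {set {set 'I_n}} :=
  [set p x |: [set y | p x == p y] | x : 'I_n].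

Lemma arc_blocksP p A :
  reflect (exists x, A = p x |: [set y | p x == p y]) (A \in arc_blocks p).
Proof. by apply: (iffP imsetP) => [[x _ ->] | [x ->]]; exists x. Qed.

Lemma eq_arc_blocks p q : p =1 q -> arc_blocks p = arc_blocks q.
Proof.
move=> epq; apply: eq_imset => x; rewrite epq; congr (_ |: _).
by apply/setP => y; rewrite !inE epq.
Qed.

Lemma is_min_inj A a b : is_min A a -> is_min A b -> a = b.
Proof.
move=> /andP[aA /forall_inP ha] /andP[bA /forall_inP hb].
by apply: val_inj => /=; have := ha _ bA; have := hb _ aA; lia.
Qed.

Lemma is_min_arc_block p x : deflationary p ->
  is_min (p x |: [set y | p x == p y]) (p x).
Proof.
move=> dp; rewrite /is_min !inE eqxx /=; apply/forall_inP => y.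
by rewrite !inE => /orP[/eqP -> | /eqP ->].
Qed.

(** A point common to two blocks is a non-minimal element of at most one of
    them, since p has a single value there; so it is the larger of the two
    minima. *)
Lemma linked_arc_blocks p : deflationary p -> linked_partition (arc_blocks p).
Proof.
move=> dp; apply/and3P; split.
- by apply/negP => /arc_blocksP[x /setP/(_ x)]; rewrite !inE eqxx orbT.
- apply/eqP/setP => x; rewrite inE; apply/bigcupP.
  exists (p x |: [set y | p x == p y]); first by apply/arc_blocksP; exists x.
  by rewrite !inE eqxx orbT.
have main x y : p x < p y ->
    [disjoint p x |: [set z | p x == p z] & p y |: [set z | p y == p z]]
 || linked (p x |: [set z | p x == p z]) (p y |: [set z | p y == p z]).
  set A := _ |: _; set B := (p y) |: _ => lt.
  have AB z : z \in A -> z \in B -> z = p y /\ p (p y) = p x.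
    rewrite !inE => /orP[/eqP-> | /eqP e1] /orP[/eqP e2 | /eqP e2].
    - by rewrite e2 in lt; lia.
    - by have := dp (p x); rewrite -e2; lia.
    - by rewrite -e2 -e1.
    by move: lt; rewrite e1 e2; lia.
  have mA : is_min A (p x) by apply: is_min_arc_block.
  have mB : is_min B (p y) by apply: is_min_arc_block.
  case: (eqVneq (p (p y)) (p x)) => [e | ne]; last first.
    apply/orP; left; rewrite disjoint_subset; apply/subsetP => z zA.
    rewrite inE; apply/negP => /(AB _ zA)[_ e].
    by rewrite e eqxx in ne.
  have pyA : p y \in A by rewrite !inE e eqxx orbT.
  have pyB : p y \in B by rewrite !inE eqxx.
  have pxA : p x \in A by rewrite !inE eqxx.
  have yB : y \in B by rewrite !inE eqxx orbT.
  have eI : A :&: B = [set p y].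
    apply/setP => z; rewrite in_setI in_set1; apply/andP/eqP => [[zA zB] | -> //].
    by have [] := AB z zA zB.
  have ge2 V a b : a \in V -> b \in V -> a != b -> 2 <= #|V|.
    by move=> aV bV ab; apply/card_gt1P; exists a, b.
  apply/orP; right; rewrite /linked; apply/and5P; split.
  - by apply: (ge2 _ _ _ pxA pyA); apply/eqP => e'; rewrite e' in lt; lia.
  - apply: (ge2 _ _ _ yB pyB); apply/eqP => /(congr1 p); rewrite e => e'.
    by rewrite e' in lt; lia.
  - by rewrite eI cards1.
  - apply/negP => /existsP[a /andP[/(is_min_inj mA) <- /(is_min_inj mB) e']].
    by rewrite e' in lt; lia.
  by apply/forall_inP => z; rewrite eI inE => /eqP->; rewrite mB orbT.
apply/forall_inP => A /arc_blocksP[x ->]; apply/forall_inP => B /arc_blocksP[y ->].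
apply/implyP => ne; have [lt|lt|/val_inj e] := ltngtP (p x) (p y).
- exact: main.
- have := main _ _ lt; rewrite disjoint_sym => /orP[-> //|].
  case/and5P=> c1 c2 c3 c4 c5; apply/orP; right; apply/and5P; split=> //.
  + by rewrite setIC.
  + by apply: contra c4 => /existsP[a]; rewrite andbC => h; apply/existsP; exists a.
  by apply/forall_inP => z; rewrite setIC orbC; apply: (forall_inP c5).
by rewrite e eqxx in ne.
Qed.

(** As for fibers, except that a block with minimum a need not contain only
    points that p sends to a: the minimum itself may be sent lower. This is
    harmless, because the points ending the crossing arcs are not minima. *)
Lemma noncrossing_arc_blocks p : deflationary p ->
  noncrossing (arc_blocks p) <-> arc_noncrossing p.
Proof.
move=> dp; split=> [nc x y [h1 h2 h3] | nc].
  have inB z : p z |: [set t | p z == p t] \in arc_blocks p.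
    by apply/arc_blocksP; exists z.
  have := forall_inP (forall_inP nc _ (inB x)) _ (inB y).
  have -> /= : p x |: [set z | p x == p z] != p y |: [set z | p y == p z].
    apply/eqP=> e; have := is_min_arc_block x dp.
    rewrite e => /(is_min_inj (is_min_arc_block y dp)) e'.
    by move: h1; rewrite e'; lia.
  case/negP; apply/exists_inP; exists (p x); first by rewrite !inE eqxx.
  apply/exists_inP; exists (p y); first by rewrite !inE eqxx.
  apply/exists_inP; exists x; first by rewrite !inE eqxx orbT.
  by apply/exists_inP; exists y; rewrite ?inE ?eqxx ?orbT ?h1 ?h2.
have nonmin u a : a \in p u |: [set t | p u == p t] ->
    p u <= a /\ (p u < a -> p a = p u).
  rewrite !inE => /orP[/eqP -> | /eqP ->]; last by [].
  by rewrite ltnn.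
apply/forall_inP=> A /arc_blocksP[u ->]; apply/forall_inP=> B /arc_blocksP[v ->].
apply/implyP => uv.
have {}uv : p u <> p v :> nat by move/val_inj => e; rewrite e eqxx in uv.
apply/negP => /exists_inP[a /nonmin[la _]] /exists_inP[b /nonmin[lb hb]].
move=> /exists_inP[a' /nonmin[_ ha]] /exists_inP[b' /nonmin[_ hb']].
case/and3P=> ab ba ab'.
have {}ha : p a' = p u by apply: ha; lia.
have {}hb' : p b' = p v by apply: hb'; lia.
have [lt|lt] : p u < p v \/ p v < p u by lia.
  by apply: (nc a' b'); rewrite ha hb'; split; lia.
have {}hb : p b = p v by apply: hb; lia.
by apply: (nc b a'); rewrite ha hb; split; lia.
Qed.

Lemma arc_blocks_NCL p : deflationary p ->
  arc_blocks p \in NCL n <-> arc_noncrossing p.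
Proof.
by move=> dp; rewrite inE linked_arc_blocks //; apply: noncrossing_arc_blocks.
Qed.

(** The covering conditions determine p: a point is non-minimal in at most one
    block, because a point shared by two blocks is the minimum of one of them.
    A point that is the minimum of one block and lies in another is sent to the
    minimum of the other, which is smaller; hence taking the smallest minimum
    among the blocks containing x gives the right value in all cases. *)
Lemma linked_partition_arc_blocks pi : linked_partition pi ->
  exists2 p, deflationary p & pi = arc_blocks p.
Proof.
case/and3P=> pi0 /eqP cpi /forall_inP lpi.
have exmin A : A \in pi -> exists a, is_min A a.
  move=> Api; have [x xA] : exists x, x \in A.
    by apply/set0Pn; apply: contra pi0 => /eqP <-.
  exists [arg min_(a < x in A) a]; case: arg_minnP => // a aA amin.
  by rewrite /is_min aA; apply/forall_inP.
have meet A B x : A \in pi -> B \in pi -> x \in A -> x \in B -> A <> B ->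
    [/\ 1 < #|A|, forall a, is_min A a -> is_min B a -> False
      & is_min A x \/ is_min B x].
  move=> Api Bpi xA xB /eqP ne.
  have := implyP (forall_inP (lpi _ Api) _ Bpi) ne.
  case/orP=> [/disjoint_setI0/setP/(_ x)|]; first by rewrite !inE xA xB.
  case/and5P=> c1 c2 c3 c4 /forall_inP c5; split=> //.
    by move=> a ha hb; case/negP: c4; apply/existsP; exists a; rewrite ha.
  by apply/orP/c5; rewrite inE xA.
(* x itself is admitted so that the search always has a candidate; this does
   not change the minimum, as some block contains x. *)
pose cand x a := (a == x) || [exists A in pi, is_min A a && (x \in A)].
pose p x := [arg min_(a < x | cand x a) a].
have pE x : cand x (p x) /\ forall a, cand x a -> p x <= a.
  by rewrite /p; case: arg_minnP => //; rewrite /cand eqxx.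
have candI A a x : A \in pi -> is_min A a -> x \in A -> cand x a.
  move=> Api mA xA; apply/orP; right.
  by apply/exists_inP; exists A; rewrite ?mA.
have dp : deflationary p by move=> x; have [_] := pE x; apply; rewrite /cand eqxx.
have pmin A a x : A \in pi -> is_min A a -> x \in A -> x != a -> p x = a.
  move=> Api mA xA xa.
  have [/orP[/eqP e | /exists_inP[B Bpi /andP[mB xB]]] le] := pE x.
    have := le _ (candI _ _ _ Api mA xA); rewrite e => h.
    have /andP[_ /forall_inP/(_ _ xA) h'] := mA.
    by case/eqP: xa; apply: val_inj => /=; lia.
  case: (eqVneq A B) => [e | /eqP ne].
    by rewrite e in mA; apply: is_min_inj mB mA.
  have [_ _ []] := meet _ _ _ Api Bpi xA xB ne.
    by move/(is_min_inj mA) => e; rewrite e eqxx in xa.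
  move/(is_min_inj mB) => e.
  have := le _ (candI _ _ _ Api mA xA); rewrite e => h.
  have /andP[_ /forall_inP/(_ _ xA) h'] := mA.
  by case/eqP: xa; apply: val_inj => /=; lia.
have blockE A a : A \in pi -> is_min A a -> A = a |: [set y | a == p y].
  move=> Api mA; have /andP[aA _] := mA; apply/setP => x; rewrite !inE.
  case: (eqVneq x a) => [-> //|xa] /=; apply/idP/eqP => [xA | e].
    by rewrite (pmin _ _ _ Api mA).
  have [] := pE x; rewrite -e => /orP[/eqP e'|]; first by rewrite e' eqxx in xa.
  case/exists_inP=> B Bpi /andP[mB xB] _; case: (eqVneq A B) => [-> // | /eqP ne].
  have /andP[aB _] := mB.
  by have [_ /(_ _ mA mB)] := meet _ _ _ Api Bpi aA aB ne.
exists p => //; apply/setP => A; apply/idP/arc_blocksP => [Api | [x ->]].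
  have [a mA] := exmin _ Api; have /andP[aA _] := mA.
  suffices [x e] : exists x, p x = a by exists x; rewrite e; apply: blockE.
  case: (boolP [exists x in A, x != a]) => [/exists_inP[x xA xa] | one].
    by exists x; apply: pmin mA xA xa.
  (* A is a singleton, so it is not linked to any other block. *)
  exists a; have [/orP[/eqP //|/exists_inP[B Bpi /andP[mB aB]]] _] := pE a.
  case: (eqVneq A B) => [e | /eqP ne].
    by rewrite e in mA; apply: is_min_inj mB mA.
  have [/card_gt1P[y [z [yA zA /eqP[]]]]] := meet _ _ _ Api Bpi aA aB ne.
  move: one; rewrite negb_exists_in => /forall_inP one.
  by have := one _ yA; have := one _ zA; rewrite !negbK => /eqP-> /eqP->.
(* If p x = x, the block covering x has minimum x. *)
suffices [B Bpi mB] : exists2 B, B \in pi & is_min B (p x).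
  by rewrite -(blockE B).
have [/orP[/eqP e | /exists_inP[B Bpi /andP[mB _]]] _] := pE x; last by exists B.
have: x \in cover pi by rewrite cpi inE.
case/bigcupP=> B Bpi xB; have [b mB] := exmin _ Bpi.
exists B => //; suffices -> : p x = b by [].
by case: (eqVneq x b) => [ <- // | xb]; apply: pmin mB xB xb.
Qed.

Lemma NCLP pi : pi \in NCL n ->
  exists p, [/\ deflationary p, arc_noncrossing p & pi = arc_blocks p].
Proof.
move=> pN; move: (pN); rewrite inE => /andP[/linked_partition_arc_blocks[p dp e] _].
by exists p; split=> //; apply/(arc_blocks_NCL dp); rewrite -e.
Qed.

(** The minimum p x of a block is covered by its own block and by the block it
    is sent into; these coincide iff p fixes p x, which is also when p x belongs
    to the fiber over itself. *)
Lemma unlinking_arc_blocks p : deflationary p ->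
  unlinking (arc_blocks p) = fibers p.
Proof.
move=> dp.
have blk z : p z |: [set t | p z == p t] \in arc_blocks p.
  by apply/arc_blocksP; exists z.
have dc x : doubly_covered (arc_blocks p) (p x) = (p (p x) != p x).
  pose A y := p y |: [set t | p y == p t].
  rewrite /doubly_covered.
  have -> : [set A in arc_blocks p | p x \in A] = [set A x; A (p x)].
    apply/setP => B; rewrite !inE; apply/andP/orP => [[/arc_blocksP[z ->]]|].
      rewrite !inE => /orP[/eqP e | /eqP e]; [left | right]; last by rewrite e.
      by rewrite /A e.
    by case=> /eqP->; rewrite blk !inE eqxx ?orbT.
  rewrite cards2; case: (eqVneq (p (p x)) (p x)) => [e | ne].
    by rewrite /A e eqxx.
  case: (A x =P A (p x)) => // e; case/eqP: ne.
  have := is_min_arc_block x dp; rewrite -/(A x) e.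
  exact: is_min_inj (is_min_arc_block _ dp).
have ub x : unlink_block (arc_blocks p) (p x |: [set t | p x == p t])
            = [set t | p x == p t].
  apply/setP => t; rewrite !inE; case: (eqVneq t (p x)) => [-> | ne] /=.
    by rewrite is_min_arc_block //= dc negbK andbT eq_sym.
  case: (p x == p t); rewrite ?andbF // andbT.
  apply/negP => /andP[/(is_min_inj (is_min_arc_block x dp)) e _].
  by rewrite e eqxx in ne.
apply/setP => V; apply/imsetP/fibersP => [[A /arc_blocksP[x ->] ->] | [x ->]].
  by exists x.
by exists (p x |: [set t | p x == p t]).
Qed.

(** * The generated partition *)

(** When p x <= x throughout, p decreases the points that it does not fix, so n
    steps always reach a fixed point. *)
Definition root p x := iter n p x.

Lemma root_fixed p x : deflationary p -> p (root p x) = root p x.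
Proof.
move=> dp; have key k : p (iter k p x) = iter k p x \/ iter k p x + k <= x.
  elim: k => [|k [e|le]] /=.
  - by right; rewrite addn0.
  - by left; rewrite !e.
  case: (eqVneq (p (iter k p x)) (iter k p x)) => [e | ne].
    by left; rewrite !e.
  right; have := dp (iter k p x).
  have {}ne: p (iter k p x) <> iter k p x :> nat.
    by move=> /val_inj e; rewrite e eqxx in ne.
  by lia.
by case: (key n) => //; have := ltn_ord x; lia.
Qed.

Lemma iter_invariant p g : (forall x, g (p x) = g x) ->
  forall k x, g (iter k p x) = g x.
Proof. by move=> gp k x; elim: k => //= k IH; rewrite gp. Qed.

Lemma root_step p x : deflationary p -> root p (p x) = root p x.
Proof. by move=> dp; rewrite -(root_fixed x dp) /root -iterSr. Qed.

Lemma root_of_fixed p x : p x = x -> root p x = x.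
Proof. exact: iter_fix. Qed.

Lemma root_min_function p : deflationary p -> min_function (root p).
Proof.
move=> dp; split=> x; last by apply: root_of_fixed; apply: root_fixed.
have le k : iter k p x <= x by elim: k => //= k IH; apply: leq_trans (dp _) IH.
exact: le.
Qed.

Lemma coarsens_fibers p g :
  coarsens (arc_blocks p) (fibers g) <-> forall x, g (p x) = g x.
Proof.
rewrite /coarsens fibers_partition /=; split=> [/forall_inP co x | gp].
  have /co/exists_inP[B /fibersP[z ->] /subsetP sB] :
    p x |: [set t | p x == p t] \in arc_blocks p by apply/arc_blocksP; exists x.
  have: x \in [set y | g z == g y] by apply: sB; rewrite !inE eqxx orbT.
  have: p x \in [set y | g z == g y] by apply: sB; rewrite !inE eqxx.
  by rewrite !inE => /eqP <- /eqP.
apply/forall_inP => A /arc_blocksP[x ->]; apply/exists_inP.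
exists [set y | g x == g y]; first exact: mem_fibers.
apply/subsetP => y; rewrite !inE => /orP[/eqP-> | /eqP e]; first by rewrite gp.
by rewrite -(gp x) e gp.
Qed.

(** Each block lies in one fiber of g iff g is invariant under p (coarsens_fibers).
    The roots are invariant, so the generated partition refines their fibers;
    and any invariant function takes the same value at x and at root p x, so
    it cannot separate points with a common root. *)
Lemma hat_arc_blocks p : deflationary p -> hat (arc_blocks p) = fibers (root p).
Proof.
move=> dp; have /hatP/andP[co /forall_inP mini] : set0 \notin arc_blocks p.
  by have /and3P[] := linked_arc_blocks dp.
have /andP[/partition_min_function[h _ eh] _] := co.
rewrite eh in co mini *; have hp := (coarsens_fibers _ _).1 co.
have /mini/refines_fibers hr : coarsens (arc_blocks p) (fibers (root p)).
  by apply/coarsens_fibers => x; apply: root_step.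
apply/eq_fibersP => x y; apply/eqP/eqP => [/hr // | e].
by rewrite -(iter_invariant hp n) -/(root p x) e iter_invariant.
Qed.

(** The path x, p x, p (p x), and so on, descends from above b to below b, hence
    must step over b at some arc. *)
Lemma arc_chain_crosses p b : deflationary p -> forall x, b < x -> root p x < b ->
  exists z, [/\ z <= x, b < z, p z <= b & root p z = root p x].
Proof.
move=> dp x; have [k] := ubnP (x : nat); elim: k x => // k IH x le bx rb.
have [lb|gb] := leqP (p x) b; first by exists x.
case: (eqVneq (p x) x) => [e | ne]; first by rewrite root_of_fixed // in rb; lia.
have {}ne: p x <> x :> nat by move=> /val_inj e; rewrite e eqxx in ne.
have := dp x => dx; have [|| z [h1 h2 h3 h4]] := IH (p x) _ gb.
- by lia.
- by rewrite root_step.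
by exists z; rewrite h4 root_step //; split=> //; lia.
Qed.

(** If the trees of x and y crossed, the path from x down to root x would have
    an arc stepping over root y, and then the path from y down to root y an arc
    stepping over the upper end z of the former: these two arcs cross. Neither
    arc can start exactly at the point it steps over, as the roots differ. *)
Lemma root_noncrossing p : deflationary p -> arc_noncrossing p ->
  arc_noncrossing (root p).
Proof.
move=> dp nc x y [h1 h2 h3].
have [z [zx bz pz rz]] := arc_chain_crosses dp h2 h1.
have pz' : p z < root p y.
  rewrite ltn_neqAle pz andbT; apply/eqP => /val_inj e.
  have := root_step z dp; rewrite e rz => e'; have := (root_min_function dp).2 y.
  by rewrite e' => e2; rewrite e2 in h1; lia.
have ry : root p y < z by [].
have zy : z < y by lia.
have [w [wy zw pw rw]] := arc_chain_crosses dp zy ry.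
have ne : p w <> z :> nat.
  move=> /val_inj e; have := root_step w dp; rewrite e rz rw => e'.
  by rewrite e' in h1; lia.
have := (root_min_function dp).1 (p w); rewrite root_step // rw => le.
by apply: (nc z w); split; lia.
Qed.

End Fibers.

(** * The cyclic successor *)

Section Cycle.

Variable n : nat.
Implicit Types (f g h p m r : 'I_n -> 'I_n) (a b x y z : 'I_n).

(** In an increasing sequence the cyclic successor of x is the next larger
    element, or the least element when x is the largest. *)
Lemma next_sorted (s : seq 'I_n) x : sorted ltn (map val s) -> x \in s ->
  (x < next s x /\ forall y, y \in s -> x < y -> next s x <= y) \/
  (next s x <= x /\ forall y, y \in s -> next s x <= y <= x).
Proof.
case: s => // y0 s /= srt xs.
have key y t : path ltn (val y) (map val t) -> x \in y :: t ->
    (x < next_at x y0 y t /\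
       forall z, z \in y :: t -> x < z -> next_at x y0 y t <= z) \/
    (next_at x y0 y t = y0 /\ forall z, z \in y :: t -> z <= x).
  elim: t y => [|u t IH] y /=.
    rewrite inE => _ /eqP ->; rewrite eqxx; right; split=> // z.
    by rewrite inE => /eqP ->.
  case/andP=> yu tp; have := order_path_min ltn_trans tp => /allP min_t.
  have umin z : z \in u :: t -> u <= z.
    by rewrite inE => /orP[/eqP -> // | /(map_f val)/min_t /ltnW].
  case: (eqVneq x y) => [-> _ | xy].
    left; split=> // z; rewrite inE => /orP[/eqP -> | /umin //].
    by rewrite ltnn.
  rewrite inE (negPf xy) => /= xt; case: (IH _ tp xt) => [[lt min] | [e max]].
    left; split=> // z; rewrite inE => /orP[/eqP -> | /min //].
    by have := umin _ xt; rewrite /= in yu; lia.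
  right; split=> // z; rewrite inE => /orP[/eqP -> | /max //].
  by have := umin _ xt; rewrite /= in yu; lia.
have min0 z : z \in y0 :: s -> y0 <= z.
  rewrite inE => /orP[/eqP -> // | /(map_f val)].
  by move/(allP (order_path_min ltn_trans srt))/ltnW.
case: (key _ _ srt xs) => [[lt min] | [-> max]]; [by left | right].
by split=> [| z zs]; rewrite min0 //= max.
Qed.

(** This retains all that the correspondence needs to know of the permutation
    that cycles through the fibers of the min function r. *)
Definition cyclic_successor r P :=
  [/\ injective P, forall x, r (P x) = r x
    & forall x, (x < P x /\ forall y, r y = r x -> x < y -> P x <= y) \/
                (P x = r x /\ forall y, r y = r x -> y <= x)].

Lemma cycle_perm_successor r : min_function r ->
  cyclic_successor r (cycle_perm (fibers r)).
Proof.
move=> [dr rr]; have tI : trivIset (fibers r).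
  by have /and3P[] := fibers_partition r.
have mE x y : (y \in enum (pblock (fibers r) x)) = (r x == r y).
  by rewrite mem_enum mem_pblock_fibers.
have PE x : cycle_perm (fibers r) x = next (enum (pblock (fibers r) x)) x.
  by rewrite cycle_permE.
have rP x : r (cycle_perm (fibers r) x) = r x.
  by apply/esym/eqP; rewrite -mE PE mem_next mE.
split=> // [|x]; first exact: perm_inj.
(* The enumeration filters that of all ordinals, which is increasing. *)
have srt : sorted ltn (map val (enum (pblock (fibers r) x))).
  have : sorted (relpre val ltn) (enum 'I_n).
    by rewrite -sorted_map val_enum_ord iota_ltn_sorted.
  rewrite sorted_map {2}/enum_mem -enumT; apply: sorted_filter => a b c.
  exact: ltn_trans.
have xs : x \in enum (pblock (fibers r) x) by rewrite mE.
have := next_sorted srt xs; rewrite -PE => -[[lt min] | [le max]].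
  by left; split=> // y e; apply: min; rewrite mE e.
right; split=> [|y e]; last first.
  by have /andP[] : cycle_perm (fibers r) x <= y <= x by apply: max; rewrite mE e.
have /andP[h _] : cycle_perm (fibers r) x <= r x <= x by apply: max; rewrite mE rr.
by apply: val_inj => /=; have := dr (cycle_perm (fibers r) x); rewrite rP; lia.
Qed.

Lemma perm_act_fibers (P : {perm 'I_n}) p :
  perm_act P^-1%g (fibers p) = fibers (p \o P).
Proof.
have preE x : [set P^-1%g t | t in [set y | p x == p y]]
              = [set y | p x == p (P y)].
  by rewrite (can_imset_pre _ (permKV P)); apply/setP => y; rewrite !inE.
apply/setP => V; apply/imsetP/fibersP => [[U /fibersP[x ->] ->] | [x ->]].
  by exists (P^-1%g x); rewrite preE /= permKV.
by exists [set y | p (P x) == p y]; rewrite ?mem_fibers ?preE.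
Qed.

(** * Shifting arcs along the cyclic successor *)

(** If p (P x) = a, the successor of a is also sent to a, since an arc from a
    point below a to it would cross the arc from a to P x. This gives
    idempotence. Shifting cannot create crossings: arcs of different blocks of r
    cannot cross anyway, and within one block P preserves the order except at
    the maximum, whose new arc starts at the minimum and encloses all others. *)
Lemma arcs_shift_min_function p r P :
    deflationary p -> arc_noncrossing p -> min_function r -> arc_noncrossing r ->
    (forall x, r (p x) = r x) -> (forall x, p x = x <-> r x = x) ->
    cyclic_successor r P ->
  [/\ min_function (p \o P), arc_noncrossing (p \o P),
      forall x, r (p (P x)) = r x
    & forall x, (forall y, r y = r x -> y <= x) -> p (P x) = r x].
Proof.
move=> dp ncp mr ncr rp fixE [injP rP Pcase]; have [dr rr] := mr.
have pr x : p (r x) = r x by apply/fixE.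
have rpP x : r (p (P x)) = r x by rewrite rp.
have pmax x : P x = r x -> p (P x) = r x by move->.
have dpP : deflationary (p \o P).
  move=> x /=; case: (Pcase x) => [[lt min] | [-> _]]; last by rewrite pr.
  rewrite leqNgt; apply/negP => h; have := min _ (rpP x) h; have := dp (P x).
  move=> le1 le2; have e : p (P x) = P x by apply: val_inj => /=; lia.
  by move/fixE: e; rewrite rP => e; have := dr x; rewrite e; lia.
split=> //.
- split=> // x /=; set a := p (P x); apply: val_inj => /=.
  have ra : r a = r x by apply: rpP.
  case: (Pcase a) => [[lt min] | [Pa amax]]; last first.
    have xa : x <= a by apply: amax.
    have ax : a <= x by apply: dpP.
    have e : a = x by apply: val_inj => /=; lia.
    by rewrite {1}e.
  have [aPx | Pxa] := ltnP a (P x); last first.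
    have e : p (P x) = P x.
      by apply: val_inj => /=; have := dp (P x); rewrite -/a in Pxa *; lia.
    have ea : r a = a by apply/fixE; rewrite /a e.
    by have := dpP a; have := dr (p (P a)); rewrite rpP ea /=; lia.
  have := min (P x); rewrite rP ra => /(_ erefl aPx) le.
  case: (eqVneq (P a) (P x)) => [-> // | /eqP ne].
  have {}ne : P a <> P x :> nat by move/val_inj.
  apply/eqP; have := dpP a; rewrite leq_eqVlt => /orP[// | lt'].
  by case: (ncp (P a) (P x)); rewrite -/a; split=> //; lia.
- move=> x y /= [h1 h2 h3]; case: (eqVneq (r x) (r y)) => [e | /eqP[]]; last first.
    by rewrite -(rpP x) -(rpP y); apply: (no_crossing mr ncr h1 h2 h3); rewrite rpP.
  case: (Pcase x) => [[ltx minx] | [_ xmax]]; last first.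
    by have := xmax y (esym e); lia.
  case: (Pcase y) => [[lty miny] | [/pmax ey _]]; last first.
    by have := dr (p (P x)); rewrite rpP e -ey; lia.
  have le := minx y (esym e) h3.
  by apply: (ncp (P x) (P y)); split; lia.
move=> x xmax; apply: pmax; case: (Pcase x) => [[lt _] | [-> //]].
by have := xmax _ (rP x); lia.
Qed.

(** Shifting in the opposite direction. The hypothesis on the maxima makes p fix
    the minima of the fibers of r; every other point is moved down within
    its fiber, so the minima are the roots. *)
Lemma min_function_unshift_arcs p m r P :
    min_function m -> arc_noncrossing m -> min_function r -> arc_noncrossing r ->
    (forall x, r (m x) = r x) ->
    (forall x, (forall y, r y = r x -> y <= x) -> m x = r x) ->
    cyclic_successor r P -> (forall x, p (P x) = m x) ->
  [/\ deflationary p, arc_noncrossing p & root p =1 r].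
Proof.
move=> mm ncm mr ncr rm mmax [injP rP Pcase] pP.
have [dm m_m] := mm; have [dr rr] := mr.
have surjP x : exists z, x = P z.
  by exists (invF injP x); rewrite f_invF.
have dp : deflationary p.
  move=> x; have [z ->] := surjP x; rewrite pP.
  case: (Pcase z) => [[lt _] | [-> zmax]]; last by rewrite mmax.
  by have := dm z; lia.
split=> //.
- move=> x y; have [z ->] := surjP x; have [w ->] := surjP y.
  rewrite !pP => -[h1 h2 h3].
  case: (Pcase z) => [[ltz minz] | [e zmax]]; last first.
    by rewrite e -(mmax z zmax) in h2; lia.
  case: (Pcase w) => [[ltw minw] | [e wmax]]; last first.
    by rewrite e -(mmax w wmax) in h3; lia.
  case: (eqVneq (r z) (r w)) => [e | /eqP[]]; last first.
    rewrite -(rm z) -(rm w).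
    by apply: (no_crossing mr ncr h1 h2 h3); rewrite rm rP.
  have zw : z < w.
    rewrite ltnNge; apply/negP => wz.
    have [lt | ge] := ltnP w z; first by have := minw z e lt; lia.
    have ezw : w = z by apply: val_inj => /=; lia.
    by rewrite ezw in h3; lia.
  have mwz : m w <= z.
    by rewrite leqNgt; apply/negP => /minz; rewrite rm -e => /(_ erefl); lia.
  have ne : m w <> z :> nat.
    by move/val_inj => e'; have := m_m w; rewrite e' => e2; rewrite e2 e' in h1; lia.
  by apply: (ncm z w); split; lia.
move=> x; have inv y : r (p y) = r y.
  by have [z ->] := surjP y; rewrite pP rm rP.
have fixr y : p y = y -> r y = y.
  have [z ->] := surjP y; rewrite pP.
  case: (Pcase z) => [[lt _] | [-> _]]; last by rewrite rr.
  by move=> e; have := dm z; rewrite e; lia.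
rewrite -(fixr _ (root_fixed x dp)); exact: iter_invariant inv _ _.
Qed.

End Cycle.

Theorem theorem3p4 (n : nat) (n_gt0 : 0 < n) :
  let f := fun pi : {set {set 'I_n}} => (cycled_unlinking pi, hat pi) in
  {in NCL n &, injective f} /\
  f @: NCL n = [set ab | [&& ab.1 \in NC n, ab.2 \in NC n & ll ab.1 ab.2]].
Proof.
move=> f.
have fE p : deflationary p -> f (arc_blocks p) =
    (fibers (p \o cycle_perm (fibers (root p))), fibers (root p)).
  move=> dp; rewrite /f /cycled_unlinking hat_arc_blocks // unlinking_arc_blocks //.
  by rewrite perm_act_fibers.
have shift (p : 'I_n -> 'I_n) : deflationary p -> arc_noncrossing p ->
    let P := cycle_perm (fibers (root p)) in
    [/\ min_function (p \o P), arc_noncrossing (p \o P),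
      forall x, root p (p (P x)) = root p x
    & forall x, (forall y, root p y = root p x -> y <= x) -> p (P x) = root p x].
  move=> dp ncp; have mr := root_min_function dp.
  apply: arcs_shift_min_function => //.
  - exact: root_noncrossing.
  - by move=> x; apply: root_step.
  - move=> x; split=> [|e]; first exact: root_of_fixed.
    by rewrite -e root_fixed.
  exact: cycle_perm_successor.
split=> [_ _ /NCLP[p [dp np ->]] /NCLP[q [dq nq ->]] | ].
  rewrite !fE // => -[efib eroot].
  have [mp _ _ _] := shift p dp np; have [mq _ _ _] := shift q dq nq.
  have epq := min_function_inj mp mq efib.
  apply: eq_arc_blocks => x; have := epq ((cycle_perm (fibers (root p)))^-1%g x).
  by rewrite /= -eroot permKV.
apply/setP => -[alpha beta]; rewrite inE /=; apply/imsetP/and3P.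
  case=> _ /NCLP[p [dp np ->]]; rewrite fE // => -[-> ->].
  have [mp ncp h1 h2] := shift p dp np; have mr := root_min_function dp.
  split; first exact/NC_fibers; last exact/ll_fibers.
  by apply/NC_fibers => //; apply: root_noncrossing.
case=> /NCP[m [mm ncm ->]] /NCP[r [mr ncr ->]] /(ll_fibers mm mr)[rm mmax].
pose P := cycle_perm (fibers r); pose p := m \o P^-1%g.
have pP x : p (P x) = m x by rewrite /p /= permK.
have [dp ncp er] := min_function_unshift_arcs mm ncm mr ncr rm mmax
  (cycle_perm_successor mr) pP.
have er' : fibers (root p) = fibers r by apply/eq_fibersP => x y; rewrite !er.
exists (arc_blocks p); first exact/arc_blocks_NCL.
rewrite fE // er'; congr pair; apply/eq_fibersP => x y.
by rewrite /= !pP.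
Qed.
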